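(* Let $x$ be a real positive number and let $\{u_n\}_{n\ge 0}$ be the sequence associated to the Babylonian method, $u_0=r$ and $u_{n+1}=\frac{u_n}{2}+\frac{x}{2u_n}$ for all $n\ge 0$, where $r$ is a real positive number. The sequence $\{u_n\}_{n\ge 0}$ can be expressed as follows: $$u_0=r,\qquad (\forall n\in\mathbb{N}^* )\quad u_n=r\left.\frac{T_{2^{n-1}}(X)}{(X-1)\,U_{2^{n-1}-1}(X)}\right|_{X=\left(\frac{x+r^2}{x-r^2}\right)}.$$ Alternately, the sequence $\{u_n\}_{n\ge 0}$ can be expressed as a product of monomials: $$u_n=r\left.\prod_{k=0}^{2^{n-1}-1}\frac{X-\cos\left(\frac{(2k+1)\pi}{2^n}\right)}{X-\cos\left(\frac{2k\pi}{2^n}\right)}\right|_{X=\left(\frac{x+r^2}{x-r^2}\right)}.$$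
   Context: $T_k$ and $U_k$ denote the Chebyshev polynomials of the first and second kind: $T_0(X)=1$, $T_1(X)=X$, $T_{k+1}(X)=2XT_k(X)-T_{k-1}(X)$; $U_0(X)=1$, $U_1(X)=2X$, $U_{k+1}(X)=2XU_k(X)-U_{k-1}(X)$. $\mathbb{N}^*$ denotes the set of positive integers. *)

(* Defs.v *)
From mathcomp Require Import all_boot all_order all_algebra.
Set Implicit Arguments.
Unset Strict Implicit.
Unset Printing Implicit Defensive.
Import GRing.Theory.
Local Open Scope ring_scope.

Fixpoint chebyT (R : nzRingType) (n : nat) : {poly R} :=
  match n with
  | 0 => 1
  | 1 => 'X
  | (k.+1 as m).+1 => 2%:R *: 'X * chebyT R m - chebyT R k
  end.

Fixpoint chebyU (R : nzRingType) (n : nat) : {poly R} :=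
  match n with
  | 0 => 1
  | 1 => 2%:R *: 'X
  | (k.+1 as m).+1 => 2%:R *: 'X * chebyU R m - chebyU R k
  end.

(* Main.v *)
Require Import Defs.
From mathcomp Require Import all_boot all_order all_algebra.
From mathcomp Require Import reals trigo.
From mathcomp Require Import ring.
Set Implicit Arguments.
Unset Strict Implicit.
Unset Printing Implicit Defensive.
Import GRing.Theory Num.Theory.
Local Open Scope ring_scope.

(** Put [X = (x + r^2)/(x - r^2)], so that [x/r^2 = (X + 1)/(X - 1)], and
    [v n = u n / r].  The Babylonian step becomes
    [v n.+1 = (v n + (X + 1)/((X - 1) v n))/2].  If [v n = T/((X - 1) U)] with
    [T = T_m(X)] and [U = U_(m-1)(X)], then
    [v n.+1 = (T^2 + (X^2 - 1) U^2)/(2 (X - 1) T U)], and the doubling formulas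
    [T_(2m) = T_m^2 + (X^2 - 1) U_(m-1)^2] and [U_(2m-1) = 2 T_m U_(m-1)]
    (special cases of the addition formulas [chebyD]) say that this is the
    same expression with [m] replaced by [2m].  As [v 1 = X/(X - 1)], the index
    [m] is [2^(n-1)] at step [n]
    ([babylonian_chebyshev]).

    The product form follows by factoring numerator and denominator.  From
    [T_m(cos a) = cos (m a)] and [U_(m-1)(cos a) sin a = sin (m a)] one reads
    off [m] distinct roots of [T_m] and [m - 1] distinct roots of [U_(m-1)],
    which is as many as the degrees allow ([chebyT_prod], [chebyU_prod]).  Both
    leading coefficients are [2^(m-1)], so they cancel, and the factor [X - 1]
    is the one of index [k = 0] in the denominator, because [cos 0 = 1]. *)

(** * Addition formulas *)

(** These two identities are the polynomial form of the expansions of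
    [cos (a + n a)] and [sin (a + n a)]; unlike the recurrences of order two,
    they are of order one and support plain inductions. *)
Lemma cheby_step (R : comNzRingType) (n : nat) :
  chebyT R n.+2 = 'X * chebyT R n.+1 + ('X ^+ 2 - 1) * chebyU R n /\
  chebyU R n.+1 = 'X * chebyU R n + chebyT R n.+1.
Proof.
elim: n => [|n [IHT IHU]]; first by rewrite /= scaler_nat; split; ring.
have -> : chebyT R n.+3 = 2%:R *: 'X * chebyT R n.+2 - chebyT R n.+1 by [].
have -> : chebyU R n.+2 = 2%:R *: 'X * chebyU R n.+1 - chebyU R n by [].
rewrite IHU IHT scaler_nat; split; ring.
Qed.

Lemma chebyTS (R : comNzRingType) (n : nat) :
  chebyT R n.+2 = 'X * chebyT R n.+1 + ('X ^+ 2 - 1) * chebyU R n.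
Proof. exact: (cheby_step R n).1. Qed.

Lemma chebyUS (R : comNzRingType) (n : nat) :
  chebyU R n.+1 = 'X * chebyU R n + chebyT R n.+1.
Proof. exact: (cheby_step R n).2. Qed.

(** [cos (a + b)] and [sin (a + b)] for [a] and [b] multiples of one angle,
    with [sin (n.+1 a)] standing for [U_n (cos a) sin a]. *)
Lemma chebyD (R : comNzRingType) (m n : nat) :
  chebyT R (m + n).+2 =
    chebyT R m.+1 * chebyT R n.+1 + ('X ^+ 2 - 1) * (chebyU R m * chebyU R n) /\
  chebyU R (m + n).+1 =
    chebyU R m * chebyT R n.+1 + chebyT R m.+1 * chebyU R n.
Proof.
elim: m => [|m [IHT IHU]].
  by rewrite add0n chebyTS chebyUS /=; split; ring.
rewrite addSn (chebyTS _ (m + n).+1) (chebyUS _ (m + n).+1) IHT IHU.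
by rewrite (chebyTS _ m) (chebyUS _ m); split; ring.
Qed.

Lemma chebyT_double (R : comNzRingType) (n : nat) :
  chebyT R (n.+1).*2 = chebyT R n.+1 ^+ 2 + ('X ^+ 2 - 1) * chebyU R n ^+ 2.
Proof. by rewrite doubleS -addnn (chebyD R n n).1 -!expr2. Qed.

Lemma chebyU_double (R : comNzRingType) (n : nat) :
  chebyU R (n.+1).*2.-1 = (chebyT R n.+1 * chebyU R n) *+ 2.
Proof. by rewrite doubleS -addnn (chebyD R n n).2 mulrC mulr2n. Qed.

(** * Factorization over the reals *)

(** Degree and leading coefficient depend on the Chebyshev recurrence only, so
    both kinds are covered at once. *)
Lemma cheby_rec_lead (R : nzRingType) (P : nat -> {poly R}) (c : R) :
  (size (P 0) <= 1)%N -> (size (P 1) <= 2)%N -> (P 1)`_1 = c ->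
  (forall n, P n.+2 = 2%:R *: 'X * P n.+1 - P n) ->
  forall n, (size (P n.+1) <= n.+2)%N /\ (P n.+1)`_n.+1 = 2%:R ^+ n * c.
Proof.
move=> sP0 sP1 lP1 recP.
suff H n : [/\ (size (P n) <= n.+1)%N, (size (P n.+1) <= n.+2)%N
             & (P n.+1)`_n.+1 = 2%:R ^+ n * c] by move=> n; case: (H n).
elim: n => [|n [sPn sPSn lPSn]]; first by rewrite expr0 mul1r.
split=> //; rewrite recP -scalerAl.
  rewrite (leq_trans (size_polyD _ _)) // size_polyN geq_max; apply/andP; split.
    rewrite (leq_trans (size_scale_leq _ _)) //.
    by rewrite (leq_trans (size_polyMleq _ _)) // size_polyX.
  by rewrite (leq_trans sPn) // ltnW.
rewrite coefB coefZ coefXM /= lPSn nth_default ?subr0 ?exprS ?mulrA //.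
by rewrite (leq_trans sPn) // ltnW.
Qed.

Lemma chebyT_lead (R : nzRingType) (n : nat) :
  (size (chebyT R n.+1) <= n.+2)%N /\ (chebyT R n.+1)`_n.+1 = 2%:R ^+ n.
Proof.
have [] := @cheby_rec_lead R (chebyT R) 1 _ _ _ (fun=> erefl) n.
- by rewrite size_poly1.
- by rewrite size_polyX.
- by rewrite coefX.
by rewrite mulr1.
Qed.

Lemma chebyU_lead (R : nzRingType) (n : nat) :
  (size (chebyU R n) <= n.+1)%N /\ (chebyU R n)`_n = 2%:R ^+ n.
Proof.
case: n => [|n]; first by rewrite size_poly1 coef1.
have [] := @cheby_rec_lead R (chebyU R) 2%:R _ _ _ (fun=> erefl) n.
- by rewrite size_poly1.
- by rewrite (leq_trans (size_scale_leq _ _)) // size_polyX.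
- by rewrite coefZ coefX mulr1.
by rewrite exprSr.
Qed.

(** Prescribing a nonzero coefficient at index [size rs] makes the degree exact,
    so that the sequence [rs] exhausts the roots of [p]. *)
Lemma poly_prod_roots (F : fieldType) (p : {poly F}) (c : F) (rs : seq F) :
  c != 0 -> (size p <= (size rs).+1)%N -> p`_(size rs) = c ->
  all (root p) rs -> uniq rs -> p = c *: \prod_(z <- rs) ('X - z%:P).
Proof.
move=> c_neq0 le_p p_c roots_p uniq_rs.
have size_p : size p = (size rs).+1.
  apply/eqP; rewrite eqn_leq le_p ltnNge; apply/negP => ge_p.
  by move: c_neq0; rewrite -p_c nth_default ?eqxx.
by rewrite {1}(all_roots_prod_XsubC size_p roots_p) ?uniq_rootsE //
     lead_coefE size_p p_c.
Qed.

(** The second identity keeps the factor [sin a] on the left so that it also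
    holds where the sine vanishes; [sin a] is cancelled only at the roots. *)
Lemma chebyTU_trigo (R : realType) (a : R) (n : nat) :
  (chebyT R n.+1).[cos a] = cos (n.+1%:R * a) /\
  (chebyU R n).[cos a] * sin a = sin (n.+1%:R * a).
Proof.
elim: n => [|n [IHT IHU]]; first by rewrite hornerX hornerC !mul1r.
have E : n.+2%:R * a = a + n.+1%:R * a by rewrite -[in LHS]natr1; ring.
rewrite chebyTS chebyUS !hornerE E cosD sinD -IHT -IHU.
have -> : cos a ^+ 2 - 1 = - sin a ^+ 2 by rewrite -(cos2Dsin2 a); ring.
split; ring.
Qed.

Lemma sin_natpi (R : realType) (k : nat) : sin (k%:R * pi) = 0 :> R.
Proof.
elim: k => [|k IHk]; first by rewrite mul0r sin0.
by rewrite -natr1 mulrDl mul1r sinDpi IHk oppr0.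
Qed.

(** The angles [j pi / M] with [j <= M] lie in [0, pi], where the cosine is
    injective. *)
Lemma cos_frac_pi_inj (R : realType) (M : nat) :
  (0 < M)%N ->
  {in [pred j | (j <= M)%N] &,
    injective (fun j : nat => cos (j%:R * pi / M%:R) : R)}.
Proof.
move=> M_gt0.
have M_gt0R : 0 < M%:R :> R by rewrite ltr0n.
have in0pi j : (j <= M)%N -> j%:R * pi / M%:R \in `[0, (pi : R)].
  move=> le_jM; rewrite in_itv /=; apply/andP; split.
    by rewrite divr_ge0 ?mulr_ge0 ?pi_ge0.
  by rewrite ler_pdivrMr // mulrC ler_pM2l ?pi_gt0 // ler_nat.
move=> i j; rewrite !inE => le_iM le_jM /(cos_inj (in0pi i le_iM) (in0pi j le_jM)).
move/(divIf (lt0r_neq0 M_gt0R))/(mulIf (lt0r_neq0 (pi_gt0 R)))/eqP.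
by rewrite eqr_nat => /eqP.
Qed.

Lemma chebyT_prod (R : realType) (n : nat) :
  chebyT R n.+1 = 2%:R ^+ n *:
    \prod_(0 <= k < n.+1)
      ('X - (cos ((2 * k + 1)%:R * pi / (2 * n.+1)%:R))%:P).
Proof.
pose root_ k : R := cos ((2 * k + 1)%:R * pi / (2 * n.+1)%:R).
have [size_T lead_T] := chebyT_lead R n.
rewrite -(big_map root_ xpredT (fun z => 'X - z%:P)).
apply: poly_prod_roots; rewrite ?size_map ?size_iota ?expf_neq0 ?pnatr_eq0 //.
  apply/allP => _ /mapP[k _ ->]; rewrite rootE (chebyTU_trigo _ n).1.
  have -> : n.+1%:R * ((2 * k + 1)%:R * pi / (2 * n.+1)%:R)
            = k%:R * pi + pi / 2%:R :> R.
    by rewrite natrD !natrM; field; rewrite addrC natr1 pnatr_eq0.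
  by rewrite cosDpihalf sin_natpi oppr0.
rewrite map_inj_in_uniq ?iota_uniq // => i j.
rewrite !mem_index_iota => /andP[_ lt_i] /andP[_ lt_j] eq_ij.
have bound k : (k < n.+1)%N -> (2 * k + 1 <= 2 * n.+1)%N.
  by move=> lt_k; rewrite addn1 ltn_mul2l.
have := cos_frac_pi_inj (ltn0Sn _) (bound i lt_i) (bound j lt_j) eq_ij.
by move/addIn/eqP; rewrite eqn_mul2l /= => /eqP.
Qed.

Lemma chebyU_prod (R : realType) (n : nat) :
  chebyU R n = 2%:R ^+ n *:
    \prod_(1 <= k < n.+1) ('X - (cos ((2 * k)%:R * pi / (2 * n.+1)%:R))%:P).
Proof.
pose angle k : R := (2 * k)%:R * pi / (2 * n.+1)%:R.
have [size_U lead_U] := chebyU_lead R n.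
rewrite -(big_map (fun k => cos (angle k)) xpredT (fun z => 'X - z%:P)).
apply: poly_prod_roots;
  rewrite ?size_map ?size_iota ?subn1 ?expf_neq0 ?pnatr_eq0 //.
  apply/allP => _ /mapP[k k_in ->]; rewrite rootE.
  move: k_in; rewrite mem_index_iota => /andP[k_gt0 lt_k].
  have sin_neq0 : sin (angle k) != 0.
    apply: lt0r_neq0; apply: sin_gt0_pi; apply/andP; split.
      by rewrite divr_gt0 ?mulr_gt0 ?pi_gt0 ?ltr0n ?muln_gt0.
    rewrite ltr_pdivrMr ?ltr0n // mulrC ltr_pM2l ?pi_gt0 //.
    by rewrite ltr_nat ltn_mul2l.
  apply/eqP/(mulIf sin_neq0); rewrite mul0r (chebyTU_trigo _ n).2.
  have -> : n.+1%:R * angle k = k%:R * pi :> R.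
    by rewrite /angle !natrM; field; rewrite addrC natr1 pnatr_eq0.
  exact: sin_natpi.
rewrite map_inj_in_uniq ?iota_uniq // => i j.
rewrite !mem_index_iota => /andP[_ lt_i] /andP[_ lt_j] eq_ij.
have bound k : (k < n.+1)%N -> (2 * k <= 2 * n.+1)%N.
  by move=> lt_k; rewrite leq_mul2l ltnW.
have := cos_frac_pi_inj (ltn0Sn _) (bound i lt_i) (bound j lt_j) eq_ij.
by move/eqP; rewrite eqn_mul2l /= => /eqP.
Qed.

(** The factor [k = 0] of the denominator is [X - 1]; the common leading
    coefficient cancels in the quotient. *)
Lemma cheby_quotient_prod (R : realType) (n : nat) (z : R) :
  (chebyT R n.+1).[z] / (('X - 1) * chebyU R n).[z] =
  \prod_(0 <= k < n.+1)
    (('X - (cos ((2 * k + 1)%:R * pi / (2 * n.+1)%:R))%:P).[z]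
     / ('X - (cos ((2 * k)%:R * pi / (2 * n.+1)%:R))%:P).[z]).
Proof.
rewrite prodf_div [X in _ = _ / X]big_ltn // muln0 !mul0r cos0.
rewrite chebyT_prod chebyU_prod hornerM !hornerZ !horner_prod polyC1 mulrCA.
by rewrite -mulf_div divff ?mul1r // expf_neq0 // pnatr_eq0.
Qed.

(** * The Babylonian iteration *)

(** The denominators of the step are safe because the iterates are positive: as
    [0^-1 = 0], a vanishing [T] or [U] would give [u = 0]. *)
Lemma babylonian_step (F : realFieldType) (x r X T U u : F) :
  0 < r -> 0 < u -> X - 1 != 0 -> x * (X - 1) = r ^+ 2 * (X + 1) ->
  u = r * (T / ((X - 1) * U)) ->
  u / 2%:R + x / (2%:R * u) =
  r * ((T ^+ 2 + (X ^+ 2 - 1) * U ^+ 2) / ((X - 1) * ((T * U) *+ 2))).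
Proof.
move=> r_gt0 u_gt0 X_neq1 x_def u_def.
have T_neq0 : T != 0.
  by apply/eqP => T0; move: (lt0r_neq0 u_gt0); rewrite u_def T0 mul0r mulr0 eqxx.
have U_neq0 : U != 0.
  by apply/eqP => U0; move: (lt0r_neq0 u_gt0); rewrite u_def U0 mulr0 invr0 !mulr0 eqxx.
have r_neq0 := lt0r_neq0 r_gt0.
have -> : x = r ^+ 2 * (X + 1) / (X - 1) by rewrite -x_def mulfK.
by rewrite u_def; field; rewrite T_neq0 U_neq0 X_neq1 r_neq0.
Qed.

Lemma babylonian_gt0 (F : realFieldType) (x : F) (u : nat -> F) :
  0 < x -> 0 < u 0%N ->
  (forall n, u n.+1 = u n / 2%:R + x / (2%:R * u n)) -> forall n, 0 < u n.
Proof.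
move=> x_gt0 u0_gt0 uS; elim=> // n IHn.
by rewrite uS addr_gt0 ?divr_gt0 ?mulr_gt0.
Qed.

Lemma babylonian_chebyshev (F : realFieldType) (x r : F) (u : nat -> F) :
  0 < x -> 0 < r -> x != r ^+ 2 -> u 0%N = r ->
  (forall n, u n.+1 = u n / 2%:R + x / (2%:R * u n)) ->
  let X0 := (x + r ^+ 2) / (x - r ^+ 2) in
  forall n, u n.+1 = r * ((chebyT F (2 ^ n)%N).[X0]
                          / (('X - 1) * chebyU F (2 ^ n).-1).[X0]).
Proof.
move=> x_gt0 r_gt0 x_neq_r2 u0 uS X0.
have r_neq0 := lt0r_neq0 r_gt0.
have xr_neq0 : x - r ^+ 2 != 0 by rewrite subr_eq0.
have X0B1 : X0 - 1 = r ^+ 2 *+ 2 / (x - r ^+ 2) by rewrite /X0; field.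
have X0_neq1 : X0 - 1 != 0.
  by rewrite X0B1 mulf_neq0 ?invr_eq0 // mulrn_eq0 expf_eq0.
have x_def : x * (X0 - 1) = r ^+ 2 * (X0 + 1) by rewrite /X0; field.
have u_gt0 : forall n, 0 < u n by apply: babylonian_gt0 x_gt0 _ uS; rewrite u0.
elim=> [|n IHn].
  rewrite uS u0 /= mulr1 -polyC1 hornerXsubC hornerX X0B1 /X0; field.
  by rewrite r_neq0 xr_neq0.
have [m m_def] : exists m, (2 ^ n)%N = m.+1.
  by exists (2 ^ n).-1; rewrite prednK // expn_gt0.
move: IHn; rewrite expnS mul2n m_def chebyT_double chebyU_double -pred_Sn.
rewrite !(hornerD, hornerN, hornerM, hornerMn, horner_exp, hornerX, hornerC).
move=> IHn.
by rewrite uS (babylonian_step r_gt0 (u_gt0 _) X0_neq1 x_def IHn).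
Qed.

Theorem corollary4 (R : realType) (x r : R) (u : nat -> R)
    (x_gt0 : 0 < x) (r_gt0 : 0 < r) (x_neq_r2 : x != r ^+ 2)
    (u0 : u 0%N = r)
    (uS : forall n : nat, u n.+1 = u n / 2%:R + x / (2%:R * u n)) :
  let X0 := (x + r ^+ 2) / (x - r ^+ 2) in
  [/\ u 0%N = r,
      forall n : nat, (0 < n)%N ->
        u n = r * ((chebyT R (2 ^ n.-1)%N).[X0]
                   / (('X - 1) * chebyU R (2 ^ n.-1).-1).[X0])
    & forall n : nat, (0 < n)%N ->
        u n = r * \prod_(0 <= k < 2 ^ n.-1)
                    (('X - (cos ((2 * k + 1)%:R * pi / 2%:R ^+ n))%:P).[X0]
                     / ('X - (cos ((2 * k)%:R * pi / 2%:R ^+ n))%:P).[X0])].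
Proof.
move=> X0.
have u_cheby := babylonian_chebyshev x_gt0 r_gt0 x_neq_r2 u0 uS.
split=> // -[//|n] _; first exact: u_cheby.
rewrite /= u_cheby -natrX expnS.
have -> : (2 ^ n)%N = (2 ^ n).-1.+1 by rewrite prednK // expn_gt0.
by rewrite cheby_quotient_prod.
Qed.
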